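(* Let $p$ be an odd prime, let $V$ be a $4$-dimensional vector space over $\mathbb{F}_p$, and let $\pi:V\to\Lambda^2V$ be a linear map of rank one. Then there exists a basis $v_1,v_2,v_3,v_4$ of $V$ such that $v_2^\pi=v_3^\pi=v_4^\pi=1$ and $v_1^\pi$ is one of $$(v_1\wedge v_2),\qquad (v_3\wedge v_4),\qquad (v_1\wedge v_2)(v_3\wedge v_4).$$
   Context: Linear maps are written as exponents; addition in $V$ and in its exterior square $\Lambda^2V$ is written multiplicatively (so $1$ denotes the zero vector, and $(v_1\wedge v_2)(v_3\wedge v_4)$ denotes the sum of the two wedge products). *)

(* Defs.v *)
From HB Require Import structures.
From mathcomp Require Import all_boot all_order all_algebra ring.

Set Implicit Arguments.
Unset Strict Implicit.
Unset Printing Implicit Defensive.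

Import GRing.Theory.
Local Open Scope ring_scope.

(* "f v v = 0" is the right condition in every characteristic; it implies
   antisymmetry. *)
Definition alternating (F : fieldType) (V U : lmodType F)
  (f : {bilinear V -> V -> U}) : Prop := forall v, f v v = 0.

(* (W, wedge) is an exterior square of V: wedge is the universal alternating
   bilinear map on V.  This determines (W, wedge) up to unique isomorphism, so
   a statement about all such pairs is a statement about "the" exterior
   square. *)
Definition is_exterior_square (F : fieldType) (V W : lmodType F)
  (wedge : {bilinear V -> V -> W}) : Prop :=
  alternating wedge /\
  forall (U : lmodType F) (f : {bilinear V -> V -> U}), alternating f ->
    exists g : {linear W -> U},
      (forall x y, g (wedge x y) = f x y) /\
      (forall g' : {linear W -> U},
         (forall x y, g' (wedge x y) = f x y) -> g' =1 g).

(* Non-vacuity, in the model F^(pairs i < j), with wedge given by the 2 x 2 minors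
   of coordinates. *)
Section Existence.
Variables (F : fieldType) (V : vectType F).

Let n := \dim {:V}.
Let T : finType := {ij : 'I_n * 'I_n | (ij.1 < ij.2)%N}.
Let c (i : 'I_n) (x : V) : F := coord (vbasis {:V}) i x.
Let e (i : 'I_n) : V := (vbasis {:V})`_i.

Definition minors (x y : V) : {ffun T -> F^o} :=
  [ffun t : T => c (val t).1 x * c (val t).2 y - c (val t).2 x * c (val t).1 y].

Fact minors_bilinear : bilinear_for *:%R *:%R minors.
Proof.
by split=> u a x y; apply/ffunP=> t; rewrite !ffunE /c !linearP /= /GRing.scale /=;
  ring.
Qed.

HB.instance Definition _ := bilinear_isBilinear.Build F V V {ffun T -> F^o}
  *:%R *:%R minors minors_bilinear.

Lemma alternating_expand (U : lmodType F) (f : {bilinear V -> V -> U}) x y :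
  alternating f ->
  f x y = \sum_(t : T) (minors x y t : F) *: f (e (val t).1) (e (val t).2).
Proof.
move=> altf.
have altN u v : f v u = - f u v.
  apply/eqP; rewrite -addr_eq0; apply/eqP; have := altf (u + v).
  by rewrite linearDl !linearDr /= !altf add0r addr0 addrC.
pose G (ij : 'I_n * 'I_n) := (c ij.1 x * c ij.2 y) *: f (e ij.1) (e ij.2).
have -> : f x y = \sum_ij G ij.
  rewrite {1}(coord_vbasis (memvf x)) {1}(coord_vbasis (memvf y)) linear_sumlz.
  rewrite -(pair_big predT predT (fun i j => G (i, j))) /=.
  apply: eq_bigr => i _; rewrite linear_sumr; apply: eq_bigr => j _.
  by rewrite linearZl_LR linearZr_LR scalerA.
pose lt12 (ij : 'I_n * 'I_n) := (ij.1 < ij.2)%N.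
pose gt12 (ij : 'I_n * 'I_n) := (ij.2 < ij.1)%N.
have -> : \sum_ij G ij = \sum_(ij | lt12 ij) G ij + \sum_(ij | gt12 ij) G ij.
  rewrite (bigID lt12) /=; congr (_ + _); rewrite (bigID gt12) /=.
  rewrite [X in _ + X]big1 ?addr0 => [|[i j] /=].
    by apply: eq_bigl => -[i j]; rewrite /lt12 /gt12 /=; case: ltngtP.
  rewrite /lt12 /gt12 /= -!leqNgt => /andP[ji ij].
  have -> : i = j by apply/val_inj/eqP; rewrite eqn_leq ij ji.
  by rewrite /G altf scaler0.
have -> : \sum_(ij | gt12 ij) G ij = \sum_(ij | lt12 ij) G (ij.2, ij.1).
  have swapK : involutive (fun ij : 'I_n * 'I_n => (ij.2, ij.1)) by case.
  by rewrite (reindex_inj (inv_inj swapK)).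
rewrite -big_split /= (reindex_omap (val : T -> _) insub) => [|ij lij].
  apply: eq_big => [[ij lij]|[[i j] ij] _] /=.
    by rewrite insubT /lt12 /= lij eqxx.
  rewrite !ffunE /G /=.
  by rewrite [f (e j) _]altN scalerN -scalerBl.
by rewrite insubT.
Qed.

Lemma exterior_square_exists :
  exists (W : vectType F) (wedge : {bilinear V -> V -> W}),
    is_exterior_square wedge.
Proof.
exists {ffun T -> F^o}, minors; split=> [v|U f altf].
  by apply/ffunP=> t; rewrite !ffunE mulrC subrr.
pose g (w : {ffun T -> F^o}) := \sum_(t : T) (w t : F) *: f (e (val t).1) (e (val t).2).
have g_lin : linear g.
  move=> a u v; rewrite /g scaler_sumr -big_split; apply: eq_bigr => t _ /=.
  by rewrite !ffunE scalerDl scalerA.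
pose gL := GRing.isLinear.Build F {ffun T -> F^o} U *:%R g g_lin.
pose g' : {linear {ffun T -> F^o} -> U} := HB.pack g gL.
exists g'; split=> [x y|h hE w]; first by rewrite [RHS]alternating_expand.
have cE (i j : 'I_n) : c i (e j) = (j == i)%:R.
  by rewrite /c /e coord_free ?(basis_free (vbasisP _)).
have {1}-> : w = \sum_(t : T) (w t : F) *: minors (e (val t).1) (e (val t).2).
  apply/ffunP=> s; rewrite sum_ffunE (bigD1 s) //= big1 ?addr0 => [|t ts].
    case: s => -[i j] /= ij; rewrite !ffunE /= !cE !eqxx.
    have -> : (i == j) = false by apply/eqP=> eij; rewrite eij ltnn in ij.
    by rewrite mul0r subr0 mulr1 /GRing.scale /= mulr1.
  case: s t ts => -[i j] /= ij [[k l] /= kl]; rewrite -val_eqE /= xpair_eqE => ne.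
  rewrite !ffunE /= !cE -!natrM !mulnb (negPf ne).
  have -> : (k == j) && (l == i) = false.
    apply/negP=> /andP[/eqP kj /eqP li]; move: kl; rewrite kj li.
    by rewrite ltnNge (ltnW ij).
  by rewrite subrr scaler0.
by rewrite linear_sum; apply: eq_bigr => t _; rewrite linearZ /= hE.
Qed.
End Existence.

(* Main.v *)
Require Import Defs.
From mathcomp Require Import all_boot all_order all_algebra.

Set Implicit Arguments.
Unset Strict Implicit.
Unset Printing Implicit Defensive.

Import GRing.Theory.
Local Open Scope ring_scope.

(** Let K be the kernel of pi, a hyperplane, and let v1 be a vector outside K.
    Since V is spanned by v1 and K, the exterior square of V is the sum of
    v1 /\ K and of the exterior square of K; and as K has dimension 3, every
    element of the latter is a single product c /\ d
    ([dim3_sum_wedges_decomposable]).  Hence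
      pi v1 = v1 /\ u + c /\ d   with u, c, d in K
    ([exterior_square_split]).  A basis v2, v3, v4 of K is now chosen according
    to the position of u relative to the plane spanned by c and d.
    - If c /\ d = 0, then u is nonzero and extends to a basis of K: the value is
      v1 /\ v2.
    - If u = 0, then c, d are independent and extend to a basis of K: the value
      is v3 /\ v4.
    - If u, c, d are independent, they are a basis of K: the value is
      v1 /\ v2 + v3 /\ v4.
    - If u is nonzero and lies in the plane of c and d, then c /\ d = x /\ u for
      some x in this plane, so pi v1 = (v1 + x) /\ u.  As x is in K, v1 + x has
      the same image as v1, and v1 + x takes the place of v1 in the first case. *)

Section ExteriorSquare.

Variables (F : fieldType) (V W : vectType F) (wedge : {bilinear V -> V -> W}).

Lemma alternating_skew x y : alternating wedge -> wedge y x = - wedge x y.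
Proof.
move=> alt; apply/eqP; rewrite -addr_eq0; apply/eqP; have := alt (x + y).
by rewrite linearDl !linearDr /= !alt add0r addr0 addrC.
Qed.

(** Containment of a span in S only has to be tested on generators, applied to
    the two linear maps obtained by fixing one argument of the product. *)
Lemma wedge_span_mem (X Y : seq V) (S : {vspace W}) :
    {in X & Y, forall x y, wedge x y \in S} ->
  {in <<X>>%VS & <<Y>>%VS, forall x y, wedge x y \in S}.
Proof.
move=> XYS.
have XS x y : x \in X -> y \in <<Y>>%VS -> wedge x y \in S.
  move=> xX; suff /subvP/(_ y) : (<<Y>> <= linfun (wedge x) @^-1: S)%VS.
    by move=> sub /sub; rewrite -memv_preim lfunE.
  by apply/span_subvP => z zY; rewrite -memv_preim lfunE; apply: XYS.
move=> x y xX yY.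
suff /subvP/(_ x xX) :
    (<<X>> <= linfun (applyr wedge y) @^-1: S)%VS.
  by rewrite -memv_preim lfunE.
by apply/span_subvP => z zX; rewrite -memv_preim lfunE; apply: XS.
Qed.

(** The projection onto S fixes all products, as does the identity; the
    uniqueness half of the universal property identifies the two. *)
Lemma exterior_square_generated (S : {vspace W}) :
    is_exterior_square wedge -> (forall x y, wedge x y \in S) ->
  forall w, w \in S.
Proof.
move=> [alt univ] wS w; have [g [_ g_uniq]] := univ W wedge alt.
have -> : w = projv S w.
  rewrite (g_uniq (projv S)) => [|x y]; last exact: projv_id.
  by rewrite -(g_uniq idfun).
exact: memv_proj.
Qed.

(** In coordinates: when the coefficient g of x /\ y is nonzero, x and y can be
    shifted along z so as to absorb the other two products; when it vanishes,
    z is a common factor. *)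
Lemma dim3_sum_wedges_decomposable (x y z : V) w :
    alternating wedge ->
    w \in <<[:: wedge x y; wedge x z; wedge y z]>>%VS ->
  exists c d, [/\ c \in <<[:: x; y; z]>>%VS, d \in <<[:: x; y; z]>>%VS
                & w = wedge c d].
Proof.
move=> alt; set K := <<[:: x; y; z]>>%VS; rewrite 2!span_cons span_seq1.
move=> /memv_addP[_ /vlineP[g ->] [_ /memv_addP[_ /vlineP[a ->]
  [_ /vlineP[b ->] ->]] ->]].
have [xK yK zK] : [/\ x \in K, y \in K & z \in K].
  by split; apply: memv_span; rewrite !inE eqxx ?orbT.
have [->|g0] := eqVneq g 0.
  exists (a *: x + b *: y), z; split; rewrite ?rpredD ?rpredZ //.
  by rewrite scale0r add0r linearDl !linearZl_LR.
exists (g *: x - b *: z), (y + (a / g) *: z).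
split; rewrite ?rpredD ?rpredN ?rpredZ //.
rewrite linearBl !linearDr /= !linearZl_LR !linearZr_LR /= alt !scaler0 addr0.
rewrite (alternating_skew y z alt) scalerN opprK !scalerA.
by rewrite mulrCA divff // mulr1 addrA.
Qed.

(** The right-hand side ranges over a sum of two subspaces, the image of
    <<x, y, z>> under v /\ _ and the span of the products of x, y, z; it holds
    the products of all generators of V, hence everything. *)
Lemma exterior_square_split (v x y z : V) (w : W) :
    is_exterior_square wedge -> <<[:: v; x; y; z]>>%VS = fullv ->
  exists u c d, [/\ u \in <<[:: x; y; z]>>%VS, c \in <<[:: x; y; z]>>%VS,
                    d \in <<[:: x; y; z]>>%VS & w = wedge v u + wedge c d].
Proof.
move=> ext gen; have alt := ext.1.
set K := <<[:: x; y; z]>>%VS.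
pose L := <<[:: wedge x y; wedge x z; wedge y z]>>%VS.
pose S := (linfun (wedge v) @: K + L)%VS.
have vS u : u \in [:: x; y; z] -> wedge v u \in S.
  move=> uK; apply: (subvP (addvSl _ _)).
  by rewrite -lfunE memv_img ?memv_span.
have [xyS xzS yzS] : [/\ wedge x y \in S, wedge x z \in S & wedge y z \in S].
  by split; apply: (subvP (addvSr _ _)); rewrite memv_span // !inE eqxx ?orbT.
have wS : w \in S.
  apply: exterior_square_generated => // a b.
  apply: (@wedge_span_mem [:: v; x; y; z] [:: v; x; y; z]);
    rewrite ?gen ?memvf // => {}a {}b.
  have [vx vy vz] : [/\ wedge v x \in S, wedge v y \in S & wedge v z \in S].
    by split; apply: vS; rewrite !inE eqxx ?orbT.
  rewrite !inE => /or4P[] /eqP-> /or4P[] /eqP->; rewrite ?alt ?mem0v //;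
    by rewrite (alternating_skew _ _ alt) memvN.
have /memv_addP[_ /memv_imgP[u uK ->] [w' w'L ->]] := wS.
have [c [d [cK dK ->]]] := dim3_sum_wedges_decomposable alt w'L.
by exists u, c, d; split; rewrite ?lfunE.
Qed.

Lemma wedge_neq0_free c d :
  alternating wedge -> wedge c d != 0 -> free [:: c; d].
Proof.
move=> alt cd0; rewrite free_cons span_seq1 seq1_free; apply/andP; split.
  by apply: contra cd0 => /vlineP[k ->]; rewrite linearZl_LR /= alt scaler0.
by apply: contra cd0 => /eqP->; rewrite linear0r.
Qed.

(** Any nonzero vector u of the plane spanned by c and d can be taken as the
    second factor of c /\ d. *)
Lemma wedge_factor u c d :
    alternating wedge -> u != 0 -> u \in <<[:: c; d]>>%VS ->
  exists2 x, x \in <<[:: c; d]>>%VS & wedge c d = wedge x u.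
Proof.
move=> alt u0; rewrite span_cons span_seq1.
move=> /memv_addP[_ /vlineP[a ->] [_ /vlineP[b ->] def_u]].
have [cP dP] : c \in (<[c]> + <[d]>)%VS /\ d \in (<[c]> + <[d]>)%VS.
  by split; [apply: (subvP (addvSl _ _)) | apply: (subvP (addvSr _ _))];
     apply: memv_line.
have [b0|b0] := eqVneq b 0.
  have a0 : a != 0.
    by apply: contraNneq u0 => a0; rewrite def_u a0 b0 !scale0r addr0.
  exists (- a^-1 *: d); first by rewrite rpredZ.
  rewrite def_u b0 scale0r addr0 linearZl_LR linearZr_LR /= scalerA mulNr.
  by rewrite mulVf // scaleN1r -alternating_skew.
exists (b^-1 *: c); first by rewrite rpredZ.
rewrite def_u linearDr /= !linearZl_LR !linearZr_LR /= alt !scaler0 add0r.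
by rewrite scalerA mulVf // scale1r.
Qed.

End ExteriorSquare.

Lemma free_extend (F : fieldType) (V : vectType F) (K : {vspace V}) (X : seq V) :
    free X -> {subset X <= K} ->
  exists2 Y, size Y = (\dim K - size X)%N & basis_of K (X ++ Y).
Proof.
move=> Xfree XK; have sXK : (<<X>> <= K)%VS by apply/span_subvP.
exists (vbasis (K :\: <<X>>)).
  rewrite size_tuple; have := dimv_cap_compl K <<X>>.
  by rewrite (capv_idPr sXK) (eqP Xfree) => <-; rewrite addKn.
have eqK : (<<X>> + (K :\: <<X>>) = K)%VS.
  by rewrite addvC -[X in (_ + X)%VS](capv_idPr sXK) addv_diff_cap.
rewrite -[K in basis_of K]eqK; apply: cat_basis; last exact: vbasisP.
  by apply/directv_addP; rewrite capvC capv_diff.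
by rewrite basisEfree Xfree subvv (eqP Xfree) leqnn.
Qed.

Lemma hyperplane_basis_cons (F : fieldType) (V : vectType F)
    (K : {vspace V}) (v : V) (X : seq V) :
    \dim {:V} = (\dim K).+1 -> v \notin K -> basis_of K X ->
  basis_of {:V} (v :: X).
Proof.
move=> dimV vK /andP[/eqP XK Xfree].
by rewrite basisEfree free_cons XK vK Xfree subvf /= -(eqP Xfree) XK dimV leqnn.
Qed.

(** The case analysis on u, c, d in the decomposition of the value of pi at a
    vector outside its kernel. *)
Lemma rank1_normal_form (F : fieldType) (V W : vectType F)
    (wedge : {bilinear V -> V -> W}) (pi : 'Hom(V, W)) :
    is_exterior_square wedge -> \dim {:V} = 4%N -> \dim (limg pi) = 1%N ->
  exists v1 v2 v3 v4 : V,
    basis_of {:V} [:: v1; v2; v3; v4] /\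
    pi v2 = 0 /\ pi v3 = 0 /\ pi v4 = 0 /\
    (pi v1 = wedge v1 v2 \/
     pi v1 = wedge v3 v4 \/
     pi v1 = wedge v1 v2 + wedge v3 v4).
Proof.
move=> ext dimV rank_pi; have alt := ext.1.
pose K := lker pi.
have dimK : \dim K = 3%N.
  by have := limg_ker_dim pi fullv; rewrite capfv rank_pi dimV addn1 => -[].
have hypK : \dim {:V} = (\dim K).+1 by rewrite dimV dimK.
have [v vK] : exists v, v \notin K.
  have : ~~ ({:V} <= K)%VS by apply/negP => /dimvS; rewrite hypK ltnn.
  by case/subvPn => v _ vK; exists v.
have finish v1 x y z : v1 \notin K -> basis_of K [:: x; y; z] ->
    [/\ basis_of {:V} [:: v1; x; y; z], pi x = 0, pi y = 0 & pi z = 0].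
  move=> v1K bX; split; first exact: hyperplane_basis_cons bX;
    by apply/eqP; rewrite -memv_ker; apply: (basis_mem bX);
       rewrite !inE eqxx ?orbT.
(* A pure product with a factor in K: two cases below reduce to this one, the
   second with v1 a translate of v by an element of K. *)
have line_case v1 u : v1 \notin K -> u \in K -> pi v1 = wedge v1 u ->
    exists v1 v2 v3 v4 : V, basis_of {:V} [:: v1; v2; v3; v4] /\
      pi v2 = 0 /\ pi v3 = 0 /\ pi v4 = 0 /\
      (pi v1 = wedge v1 v2 \/ pi v1 = wedge v3 v4 \/
       pi v1 = wedge v1 v2 + wedge v3 v4).
  move=> v1K uK piv.
  have u0 : u != 0.
    by apply: contraNneq v1K => u0; rewrite memv_ker piv u0 linear0r.
  have ufree : free [:: u] by rewrite seq1_free.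
  have uX : {subset [:: u] <= K} by move=> t; rewrite inE => /eqP->.
  have [[|y [|z [|? ?]]]] := free_extend ufree uX; rewrite dimK //=.
  move=> _ bK; have [b p1 p2 p3] := finish _ _ _ _ v1K bK.
  by exists v1, u, y, z; do !split=> //; left.
have nilK : {subset [::] <= K} by [].
have [[|x [|y [|z [|? ?]]]]] := free_extend (nil_free V) nilK;
  rewrite dimK //= => _ bK.
have /andP[/eqP genK _] := bK.
have /andP[/eqP genV _] := hyperplane_basis_cons hypK vK bK.
have [u [c [d]]] := exterior_square_split (pi v) ext genV.
rewrite genK => -[uK cK dK piv].
have [cd0|cd0] := eqVneq (wedge c d) 0.
  by apply: (line_case v u); rewrite // piv cd0 addr0.
have cdfree := wedge_neq0_free alt cd0.
have cdK : (<<[:: c; d]>> <= K)%VS.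
  by apply/span_subvP => t; rewrite !inE => /orP[] /eqP->.
have [u0|u0] := eqVneq u 0.
  have cdX : {subset [:: c; d] <= K}.
    by move=> t tcd; apply: (subvP cdK); apply: memv_span.
  have [[|t [|? ?]]] := free_extend cdfree cdX; rewrite dimK //=.
  move=> _ bcd.
  have btcd : basis_of K [:: t; c; d].
    by rewrite -(perm_basis K (introT permPl (perm_rcons t [:: c; d]))).
  have [b p1 p2 p3] := finish _ _ _ _ vK btcd.
  exists v, t, c, d; do !split=> //; right; left.
  by rewrite piv u0 linear0r add0r.
have [ucd|ucd] := boolP (u \in <<[:: c; d]>>%VS).
  have [s scd def_cd] := wedge_factor alt u0 ucd.
  have sK : s \in K := subvP cdK _ scd.
  have pis : pi s = 0 by apply/eqP; rewrite -memv_ker.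
  apply: (line_case (v + s) u) => //; first by rewrite rpredDr.
  by rewrite linearD /= pis addr0 piv def_cd linearDl.
have bucd : basis_of K [:: u; c; d].
  rewrite basisEfree free_cons ucd cdfree dimK /= andbT.
  by apply/span_subvP => t; rewrite !inE => /or3P[] /eqP->.
have [b p1 p2 p3] := finish _ _ _ _ vK bucd.
by exists v, u, c, d; do !split=> //; right; right.
Qed.

Theorem proposition3p6 (p : nat) (p_pr : prime p) (p_odd : odd p)
  (V W : vectType 'F_p) (wedge : {bilinear V -> V -> W})
  (wedge_ext : is_exterior_square wedge) (dimV : \dim {:V} = 4%N)
  (pi : 'Hom(V, W)) (rank_pi : \dim (limg pi) = 1%N) :
  exists v1 v2 v3 v4 : V,
    basis_of {:V} [:: v1; v2; v3; v4] /\
    pi v2 = 0 /\ pi v3 = 0 /\ pi v4 = 0 /\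
    (pi v1 = wedge v1 v2 \/
     pi v1 = wedge v3 v4 \/
     pi v1 = wedge v1 v2 + wedge v3 v4).
Proof. exact: rank1_normal_form. Qed.
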